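(* Work in homotopy type theory with function extensionality. Let $f : A \to B$, $g : B \to A$, $\eta : gf \sim \mathsf{id}_A$, $\varepsilon : fg \sim \mathsf{id}_B$ and $\theta : \eta_g \sim g[\varepsilon]$. Then \[ \sum_{\tau : f[\eta] \sim \varepsilon_{f}} \big(\mathsf{Coh}\, \eta \cdot g\llbracket \tau \rrbracket \sim \theta_f\big) \;\simeq\; \prod_{x : A} \Big( \big( f[\eta_x],\, (\mathsf{Coh}\, \eta)_x^{-1} \cdot \theta_{fx} \big) = \big( \varepsilon_{fx},\, \mathsf{refl}_{g[\varepsilon_{fx}]} \big) \Big), \] where both pairs are regarded as elements of the fiber $\mathsf{fib}_{g[-]}\big(g[\varepsilon_{fx}]\big) :\equiv \sum_{p : f(g(fx)) = fx} \big(g[p] = g[\varepsilon_{fx}]\big)$ of the map $g[-] : (f(g(fx)) = fx) \to (g(f(g(fx))) = g(fx))$.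
   Context: Notation: for $h : X \to Y$ and a path $p$, $h[p]$ denotes $\mathsf{ap}_h(p)$; for 2-paths $\alpha : p = q$, $h\llbracket \alpha \rrbracket : h[p] = h[q]$ is the action of $h$ on 2-paths. A homotopy $H : F \sim G$ is an element of $\prod_x Fx = Gx$. For a homotopy $H$: $H_k := \lambda c.\, H_{kc}$, $h[H] := \lambda x.\, h[H_x]$, and for $\alpha : H \sim H'$ (i.e. $\prod_x H_x = H'_x$), $h\llbracket \alpha\rrbracket := \lambda x.\, h\llbracket \alpha_x\rrbracket$; $\cdot$ is pointwise concatenation in diagrammatic order. The homotopy $\mathsf{Coh}\, \eta : \eta_{gf} \sim g[f[\eta]]$ is defined pointwise: $(\mathsf{Coh}\,\eta)_x : \eta_{g(fx)} = g[f[\eta_x]]$ is the concatenation of the path $\eta_{g(fx)} = (gf)[\eta_x]$ given by naturality of $\eta$ (applied to $\eta_x$, cancelling $\eta_x$) with the functoriality path $(gf)[\eta_x] = g[f[\eta_x]]$. *)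

(* Defs.v *)
Set Implicit Arguments.

Inductive paths {A : Type} (a : A) : A -> Type := idpath : paths a a.
Arguments idpath {A a}, [A] a.
Notation "x == y" := (paths x y) (at level 70, no associativity) : type_scope.

Definition concat {A : Type} {x y z : A} (p : x == y) (q : y == z) : x == z :=
  match q in (_ == z') return x == z' with idpath => p end.
Notation "p @ q" := (concat p q) (at level 20, left associativity).

Definition inv {A : Type} {x y : A} (p : x == y) : y == x :=
  match p in (_ == y') return y' == x with idpath => idpath end.
Notation "p ^-1" := (inv p) (at level 3, format "p '^-1'").

(* h[p] = ap h p ; h[[alpha]] = ap (ap h) alpha *)
Definition ap {A B : Type} (h : A -> B) {x y : A} (p : x == y) : h x == h y :=
  match p in (_ == y') return h x == h y' with idpath => idpath end.

Definition ap2 {A B : Type} (h : A -> B) {x y : A} {p q : x == y}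
  (alpha : p == q) : ap h p == ap h q := ap (ap h) alpha.

Definition Htpy {A : Type} {P : A -> Type} (F G : forall x, P x) : Type :=
  forall x, F x == G x.

Definition IsEquiv {X Y : Type} (e : X -> Y) : Type :=
  ({ s : Y -> X & forall y, e (s y) == y } *
   { r : Y -> X & forall x, r (e x) == x })%type.

Definition Equiv (X Y : Type) : Type := { e : X -> Y & IsEquiv e }.

Definition happly {A : Type} {P : A -> Type} {F G : forall x, P x}
  (p : F == G) : Htpy F G :=
  fun x => match p in (_ == G') return F x == G' x with idpath => idpath end.

Definition Funext : Type :=
  forall (A : Type) (P : A -> Type) (F G : forall x, P x), IsEquiv (@happly A P F G).

Definition concat_1p {A : Type} {x y : A} (p : x == y) : idpath @ p == p :=
  match p as p' in (_ == y') return idpath @ p' == p' with idpath => idpath end.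

Definition nat_id {A : Type} {F : A -> A} (H : forall x, F x == x)
  {x y : A} (p : x == y) : H x @ p == ap F p @ H y :=
  match p as p' in (_ == y') return H x @ p' == ap F p' @ H y' with
  | idpath => (concat_1p (H x))^-1 end.

Definition cancelR {A : Type} {x y z : A} (a b : x == y) (r : y == z)
  : a @ r == b @ r -> a == b :=
  match r as r' in (_ == z') return a @ r' == b @ r' -> a == b with
  | idpath => fun e => e end.

Definition ap_compose {A B C : Type} (f : A -> B) (g : B -> C) {x y : A}
  (p : x == y) : ap (fun a => g (f a)) p == ap g (ap f p) :=
  match p as p' in (_ == y') return ap (fun a => g (f a)) p' == ap g (ap f p')
  with idpath => idpath end.

Definition Coh {A B : Type} (f : A -> B) (g : B -> A)
  (eta : forall a, g (f a) == a) (x : A) : eta (g (f x)) == ap g (ap f (eta x)) :=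
  cancelR (eta (g (f x))) (ap (fun a => g (f a)) (eta x)) (eta x)
          (nat_id eta (eta x))
  @ ap_compose f g (eta x).

(* Main.v *)
Require Import Defs.

(* By the type-theoretic axiom of choice the left-hand side is the product over
   [x] of the types [Σ (r : f[η_x] = ε_{fx}), Coh_x · g⟦r⟧ = θ_{fx}].
   Transposing [Coh_x] turns the equation into [Coh_x^-1 · θ_{fx} = g⟦r⟧], and a
   path [r] between base points together with such a 2-path is exactly a path
   between the two given points of the fibre of [g[-]]. *)

Record QEquiv (X Y : Type) := {
  qe_fun : X -> Y;
  qe_inv : Y -> X;
  qe_sect : forall y, qe_fun (qe_inv y) == y;
  qe_retr : forall x, qe_inv (qe_fun x) == x }.
Arguments Build_QEquiv {X Y}.
Arguments qe_fun {X Y}.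
Arguments qe_inv {X Y}.
Arguments qe_sect {X Y}.
Arguments qe_retr {X Y}.

Definition equiv_of_qequiv {X Y : Type} (e : QEquiv X Y) : Equiv X Y :=
  existT _ (qe_fun e)
    (existT _ (qe_inv e) (qe_sect e), existT _ (qe_inv e) (qe_retr e)).

Definition equiv_compose {X Y Z : Type} (e1 : QEquiv X Y) (e2 : QEquiv Y Z)
  : QEquiv X Z.
Proof.
  refine (Build_QEquiv (fun x => qe_fun e2 (qe_fun e1 x))
                       (fun z => qe_inv e1 (qe_inv e2 z)) _ _).
  - intro z. exact (ap (qe_fun e2) (qe_sect e1 (qe_inv e2 z)) @ qe_sect e2 z).
  - intro x. exact (ap (qe_inv e1) (qe_retr e2 (qe_fun e1 x)) @ qe_retr e1 x).
Defined.

Definition equiv_functor_sigma_id {A : Type} {P Q : A -> Type}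
  (e : forall a, QEquiv (P a) (Q a)) : QEquiv {a : A & P a} {a : A & Q a}.
Proof.
  refine (Build_QEquiv (fun u => existT Q (projT1 u) (qe_fun (e _) (projT2 u)))
                       (fun u => existT P (projT1 u) (qe_inv (e _) (projT2 u))) _ _).
  - intros [a q]. exact (ap (existT Q a) (qe_sect (e a) q)).
  - intros [a p]. exact (ap (existT P a) (qe_retr (e a) p)).
Defined.

Section Funext.
Context (funext : Funext).

Definition path_forall {A : Type} {P : A -> Type} {F G : forall x, P x}
  (H : Htpy F G) : F == G :=
  projT1 (fst (funext A P F G)) H.

Definition equiv_functor_forall_id {A : Type} {P Q : A -> Type}
  (e : forall a, QEquiv (P a) (Q a)) : QEquiv (forall a, P a) (forall a, Q a).
Proof.
  refine (Build_QEquiv (fun k a => qe_fun (e a) (k a))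
                       (fun k a => qe_inv (e a) (k a)) _ _).
  - intro k. apply path_forall. intro a. exact (qe_sect (e a) (k a)).
  - intro k. apply path_forall. intro a. exact (qe_retr (e a) (k a)).
Defined.

Definition equiv_sig_coind {A : Type} {P : A -> Type} {R : forall a, P a -> Type}
  : QEquiv {t : forall a, P a & forall a, R a (t a)}
           (forall a, {r : P a & R a r}).
Proof.
  refine (Build_QEquiv
            (fun (u : {t : forall a, P a & forall a, R a (t a)}) a =>
               existT (R a) (projT1 u a) (projT2 u a))
                       (fun k => existT (fun t => forall a, R a (t a))
                                        (fun a => projT1 (k a))
                                        (fun a => projT2 (k a))) _ _).
  - intro k. apply path_forall. intro a. simpl. destruct (k a). exact idpath.
  - intros [t r]. exact idpath.
Defined.

End Funext.

Definition concat_V_pp {X : Type} {x y z : X} (p : x == y) (q : y == z)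
  : p^-1 @ (p @ q) == q :=
  match q with idpath => match p with idpath => idpath end end.

Definition concat_p_Vp {X : Type} {x y z : X} (p : x == y) (q : x == z)
  : p @ (p^-1 @ q) == q :=
  match q with idpath => match p with idpath => idpath end end.

Definition concat_pp_V {X : Type} {x y z : X} (p : x == y) (q : y == z)
  : (p @ q) @ q^-1 == p :=
  match q with idpath => idpath end.

Definition equiv_concat_transpose_l {X : Type} {a b c : X}
  (C : a == b) (s : b == c) (T : a == c)
  : QEquiv (C @ s == T) (C^-1 @ T == s).
Proof.
  refine (Build_QEquiv
            (fun d => match d in (_ == T') return C^-1 @ T' == s with
                      | idpath => concat_V_pp C s end)
            (fun e => match e in (_ == s') return C @ s' == T with
                      | idpath => concat_p_Vp C T end) _ _).
  - intro e. destruct e, T, C. exact idpath.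
  - intro d. destruct d, s, C. exact idpath.
Defined.

Section HFiber.
Context {Y Z : Type} (h : Y -> Z) (c : Z).

Definition path_hfiber (u v : {y : Y & h y == c})
  (re : {r : projT1 u == projT1 v & projT2 u == ap h r @ projT2 v}) : u == v.
Proof.
  destruct u as [y q], v as [y' q'], re as [r e]. simpl in *.
  destruct r.
  exact (ap (existT _ y) (e @ concat_1p q')).
Defined.

Definition path_hfiber_inv {u v : {y : Y & h y == c}} (w : u == v)
  : {r : projT1 u == projT1 v & projT2 u == ap h r @ projT2 v} :=
  match w with idpath => existT _ idpath (concat_1p (projT2 u))^-1 end.

Lemma path_hfiber_inv_ap_existT {y : Y} {q q' : h y == c} (e : q == q')
  : path_hfiber_inv (ap (existT (fun y => h y == c) y) e)
    == existT (fun r : y == y => q == ap h r @ q') idpath (e @ (concat_1p q')^-1).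
Proof.
  destruct e. simpl. destruct q. exact idpath.
Qed.

Definition equiv_path_hfiber (u v : {y : Y & h y == c})
  : QEquiv {r : projT1 u == projT1 v & projT2 u == ap h r @ projT2 v} (u == v).
Proof.
  refine (Build_QEquiv (path_hfiber u v) (@path_hfiber_inv u v) _ _).
  - intro w. destruct w, u as [y q]. simpl. destruct q. exact idpath.
  - destruct u as [y q], v as [y' q']. intros [r e]. simpl in r, e.
    destruct r. unfold path_hfiber. simpl.
    exact (path_hfiber_inv_ap_existT (e @ concat_1p q')
           @ ap (existT _ idpath) (concat_pp_V e (concat_1p q'))).
Defined.

End HFiber.

Theorem lemma3p4 (funext : Funext) (A B : Type) (f : A -> B) (g : B -> A)
  (eta : forall a : A, g (f a) == a) (eps : forall b : B, f (g b) == b)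
  (theta : forall b : B, eta (g b) == ap g (eps b)) :
  Equiv
    { tau : forall x : A, ap f (eta x) == eps (f x)
    & forall x : A, Coh f g eta x @ ap2 g (tau x) == theta (f x) }
    (forall x : A,
       @existT (f (g (f x)) == f x)
               (fun p => ap g p == ap g (eps (f x)))
               (ap f (eta x)) ((Coh f g eta x)^-1 @ theta (f x))
       ==
       @existT (f (g (f x)) == f x)
               (fun p => ap g p == ap g (eps (f x)))
               (eps (f x)) idpath).
Proof.
  apply equiv_of_qequiv.
  refine (equiv_compose
            (equiv_sig_coind funext
               (R := fun x r => Coh f g eta x @ ap2 g r == theta (f x)))
            (equiv_functor_forall_id funext _)).
  intro x.
  exact (equiv_compose
           (equiv_functor_sigma_id (fun r => equiv_concat_transpose_l _ _ _))
           (equiv_path_hfiber (ap g) _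
              (existT _ (ap f (eta x)) ((Coh f g eta x)^-1 @ theta (f x)))
              (existT _ (eps (f x)) idpath))).
Qed.
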